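(* Assume the P-ideal dichotomy $\mathrm{PID}$. The following are equivalent: (1) $\min\{\mathfrak{b}, \mathrm{cof}(\mathcal{F}_\sigma)\} > \omega_1$. (2) $1$, $\omega$, $\omega_1$, $\omega \times \omega_1$, and $[\omega_1]^{<\omega}$ are the only cofinal types of directed sets of size at most $\aleph_1$; that is, every directed set of size at most $\aleph_1$ is Tukey equivalent to one of these five.
   Context: $\mathrm{PID}$: for every set $X$ and every P-ideal $\mathcal{I} \subset [X]^{\leq\omega}$, either there is an uncountable $Y \subset X$ with $[Y]^{\leq \omega} \subset \mathcal{I}$, or there are sets $X_n$ ($n\in\omega$) with $X = \bigcup_{n\in\omega} X_n$ and $[X_n]^{\omega} \cap \mathcal{I} = \emptyset$ for every $n$. Here an ideal $\mathcal{I}$ of countable subsets of $X$ (closed under subsets and finite unions, containing the finite subsets) is a P-ideal if for every countable $\{A_n : n\in\omega\} \subset \mathcal{I}$ there is $A \in \mathcal{I}$ with $A_n \subset^* A$ (i.e. $A_n\setminus A$ finite) for all $n$. A (nonempty) poset $\langle D, \leq\rangle$ is directed if any two members have an upper bound in $D$. A subset is unbounded if it has no upper bound in $D$, and $X\subset D$ is cofinal if every $y \in D$ is $\leq$ some $x \in X$. $D \leq_T E$ (Tukey reducibility) means there is $f: D \to E$ mapping unbounded subsets of $D$ to unbounded subsets of $E$; $D \equiv_T E$ (Tukey equivalent, same cofinal type) means $D \leq_T E$ and $E \leq_T D$. $1$ is the one-point poset, $\omega \times \omega_1$ has the product order and $[\omega_1]^{<\omega}$ is ordered by inclusion. $\mathfrak{b}$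 is the least size of a subset of $\omega^\omega$ that is unbounded with respect to $<^*$, where $f <^* g$ means $f(n) < g(n)$ for all but finitely many $n$. Subset $X$ of a directed set $D$ is pseudobounded if every infinite countable $A \subset X$ has an infinite $B \subset A$ bounded in $D$. $D$ is $\sigma$-pseudobounded if it is a union of countably many pseudobounded subsets. Ideals on $\omega$ are proper, contain all finite sets, and are ordered by inclusion $\subset$; an ideal on $\omega$ is tall if every infinite subset of $\omega$ has an infinite subset in the ideal; $F_\sigma$ refers to the usual topology on $\mathcal{P}(\omega)$. $\mathrm{cof}(\mathcal{F}_\sigma)$ is the least $\kappa$ such that there exist a tall, $\sigma$-pseudobounded $F_\sigma$ ideal $\mathcal{I}$ on $\omega$ and a directed cofinal $X \subset \mathcal{I}$ with $|X| = \kappa$. *)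

(* Defs.v *)
From HB Require Import structures.
From mathcomp Require Import all_boot all_order.
From mathcomp Require Import all_classical.
From mathcomp Require Import wochoice topology cantor borel_hierarchy.

Set Implicit Arguments.
Unset Strict Implicit.
Unset Printing Implicit Defensive.

Import Order.TTheory.

Local Open Scope classical_set_scope.
Local Open Scope card_scope.

(* Every subset D of a poset carries the induced order, and the notions below are
   relative to D: in particular upper bounds are taken in D. *)

Section Directed.
Context {d : Order.disp_t} {T : porderType d}.
Implicit Types D X A B : set T.

Definition bounded_in D A : Prop := (D `&` ubound A) !=set0.

Definition directed D : Prop :=
  D !=set0 /\
  forall x y, D x -> D y -> exists z, [/\ D z, (x <= z)%O & (y <= z)%O].

Definition cofinal D X : Prop :=
  X `<=` D /\ forall y, D y -> exists2 x, X x & (y <= x)%O.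

Definition pseudobounded D X : Prop :=
  X `<=` D /\
  forall A, A `<=` X -> infinite_set A -> countable A ->
    exists B, [/\ B `<=` A, infinite_set B & bounded_in D B].

Definition sigma_pseudobounded D : Prop :=
  exists2 X : nat -> set T,
    forall n, pseudobounded D (X n) & D = \bigcup_n X n.

End Directed.

Section Tukey.
Context {d d' : Order.disp_t} {T : porderType d} {U : porderType d'}.

Definition tukey_le (D : set T) (E : set U) : Prop :=
  exists2 f : T -> U, set_fun D E f &
    forall A, A `<=` D -> ~ bounded_in D A -> ~ bounded_in E (f @` A).

End Tukey.

Definition tukey_equiv {d d' : Order.disp_t} {T : porderType d}
    {U : porderType d'} (D : set T) (E : set U) : Prop :=
  tukey_le D E /\ tukey_le E D.

(* A member of P of least cardinality (set0 if P is empty, see least_cardP). *)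
Definition least_card {T : Type} (P : set (set T)) : set T :=
  xget set0 [set A | P A /\ forall B, P B -> A #<= B].

Section LeastCard.
Context {T : Type}.
Variables (P : set (set T)).

(* Families of choice functions on P that are pairwise distinct at every
   coordinate. *)
Let partial_matching (S : set (set T -> T)) : Prop :=
  (forall f A, S f -> P A -> A (f A)) /\
  (forall f g A, S f -> S g -> P A -> f A = g A -> f = g).

Let exists_least : P !=set0 -> exists A, P A /\ forall B, P B -> A #<= B.
Proof.
move=> [A0 PA0].
have [F FP Ftot|S [[Sin Sinj] Smax]] := @Zorn_bigcup _ partial_matching.
  split=> [f A [X FX Xf] PA|f g A [X FX Xf] [Y FY Yg] PA fg].
    by have [h _] := FP _ FX; exact: (h f A).
  have [XY|YX] := Ftot _ _ FX FY.
    by have [_ h] := FP _ FY; apply: (h f g A) => //; exact: XY.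
  by have [_ h] := FP _ FX; apply: (h f g A) => //; exact: YX.
have [A [PA Asurj]] : exists A, P A /\ forall x, A x -> exists2 f, S f & f A = x.
  apply: contrapT => noA.
  have free A : {x | P A -> A x /\ forall f, S f -> f A <> x}.
    apply: cid; have [PA|nPA] := pselect (P A); last first.
      have [[x _]|A0E] := pselect (A0 !=set0); first by exists x.
      by case: noA; exists A0; split=> // x A0x; case: A0E; exists x.
    apply: contrapT => nox; apply: noA; exists A; split=> // x Ax.
    apply: contrapT => nof; apply: nox; exists x => _; split=> // f Sf fAx.
    by apply: nof; exists f.
  pose g A := sval (free A).
  have gP A : P A -> A (g A) /\ forall f, S f -> f A <> g A := svalP (free A).
  apply: (Smax (S `|` [set g])).
    split; first by move=> f; left.
    by move=> /(_ g (or_intror erefl)) Sg; have [_ /(_ _ Sg)] := gP _ PA0.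
  split=> [f A [/Sin|->]|f h A [Sf|->] [Sh|->] PA fh] //.
  - exact.
  - by move=> /gP[].
  - exact: Sinj fh.
  - by have [_ /(_ _ Sf)] := gP _ PA.
  - by have [_ /(_ _ Sh)] := gP _ PA; case.
exists A; split=> // B PB; apply: (@card_le_trans _ _ _ S).
  apply: card_le_trans (card_image_le (fun f => f A) S).
  by apply: subset_card_le => x /Asurj[f Sf <-]; exists f.
have inj : {in S &, injective (fun f => f B)}.
  by move=> f g /set_mem Sf /set_mem Sg /Sinj; apply.
have /card_eqPle[_ le_im] := inj_card_eq inj.
apply: (card_le_trans le_im); apply: subset_card_le => _ [f Sf <-]; exact: (Sin f B).
Qed.

Lemma least_cardP : P !=set0 ->
  P (least_card P) /\ forall B, P B -> least_card P #<= B.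
Proof. by move=> /exists_least; exact: xgetPex. Qed.

End LeastCard.

Definition card_min {T U : Type} (A : set T) (B : set U) : Type :=
  if A #<= B then set_type A else set_type B.

Definition card_lt {T U : Type} (A : set T) (B : set U) : bool :=
  (A #<= B) && ~~ (B #<= A).

(* omega1 is the initial segment of points with countably many predecessors in
   a well-ordering of the uncountable type [set nat]; by the three lemmas below
   it is the uncountable well-order with countable proper initial segments. *)
Definition set_nat_wo : rel (set nat) :=
  sval (well_ordering_principle (set nat)).

Definition omega1 : Type :=
  {x : set nat | `[< countable [set y | set_nat_wo y x] >]}.

HB.instance Definition _ := Choice.on omega1.

Section Omega1.

Let le (x y : omega1) : bool := set_nat_wo (val x) (val y).

Let woP : well_order set_nat_wo := svalP (well_ordering_principle (set nat)).

Let woT : wo_chain set_nat_wo predT.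
Proof. by move=> A _; exact: woP. Qed.

Let wo_min (A : set (set nat)) : A !=set0 ->
  exists2 x, A x & forall y, A y -> set_nat_wo x y.
Proof.
move=> [x Ax]; have [|z [[+ zmin] _]] := woP (A := [pred x | x \in A]).
  by exists x; exact: mem_set.
move=> /set_mem Az; exists z => // y Ay.
by apply: zmin; exact: mem_set.
Qed.

Let wo_refl : reflexive set_nat_wo.
Proof. by move=> x; rewrite (wo_chain_reflexive woT). Qed.

Let wo_anti : antisymmetric set_nat_wo.
Proof. by move=> x y /(wo_chain_antisymmetric woT); apply. Qed.

Let wo_total : total set_nat_wo.
Proof. by move=> x y; exact: (wo_chainW woT). Qed.

Let wo_trans : transitive set_nat_wo.
Proof.
move=> y x z xy yz.
have [|m] := wo_min (A := [set t | [\/ t = x, t = y | t = z]]).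
  by exists x; constructor 1.
move=> /= + mle; have mx := mle x; have my := mle y; have mz := mle z.
case=> mE; move: mx my mz; rewrite mE => mx my mz.
- by apply: mz; constructor 3.
- have yx : set_nat_wo y x by apply: mx; constructor 1.
  by have -> : x = y by apply: wo_anti; rewrite xy yx.
- have zy : set_nat_wo z y by apply: my; constructor 2.
  by have <- : y = z by apply: wo_anti; rewrite yz zy.
Qed.

Let le_refl : reflexive le. Proof. by move=> x; exact: wo_refl. Qed.

Let le_anti : antisymmetric le.
Proof. by move=> x y /wo_anti/val_inj. Qed.

Let le_trans : transitive le. Proof. by move=> y x z; exact: wo_trans. Qed.

Let le_total : total le. Proof. by move=> x y; exact: wo_total. Qed.

Fact omega1_display : Order.disp_t. Proof. exact: Order.Disp tt tt. Qed.

HB.instance Definition _ :=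
  Order.Le_isPOrder.Build omega1_display omega1 le_refl le_anti le_trans.
HB.instance Definition _ :=
  Order.POrder_isTotal.Build omega1_display omega1 le_total.

Lemma omega1_well_founded (A : set omega1) : A !=set0 ->
  exists2 x, A x & forall y, A y -> (x <= y)%O.
Proof.
move=> [x Ax]; have [|_ [z Az <-] zmin] := wo_min (A := val @` A).
  by exists (val x), x.
by exists z => // y Ay; apply: zmin; exists y.
Qed.

Lemma omega1_initial_countable (x : omega1) : countable [set y | (y <= x)%O].
Proof.
have /asboolP := valP x; apply: card_le_trans.
have inj : {in [set y | (y <= x)%O] &, injective (val : omega1 -> set nat)}.
  by move=> y z _ _; exact: val_inj.
have /card_eqPle[_ le_im] := inj_card_eq inj.
by apply: (card_le_trans le_im); apply: subset_card_le => _ [y yx <-].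
Qed.

Lemma omega1_uncountable : ~ countable [set: omega1].
Proof.
move=> cT; pose S := [set x | countable [set y | set_nat_wo y x]].
have cS : countable S.
  apply: card_le_trans cT.
  apply: card_le_trans (card_image_le (val : omega1 -> set nat) setT).
  apply: subset_card_le => x Sx.
  by exists (exist _ x (asboolT Sx) : omega1).
have [ST|] := pselect ([set: set nat] `<=` S).
  have ST' : [set: set nat] #<= [set: nat] :=
    card_le_trans (subset_card_le ST) cS.
  have /pcard_injP[f f_inj] := ST'.
  have {}f_inj : injective f by move=> A B; apply: f_inj; exact/mem_set.
  pose C := [set n | exists2 A : set nat, f A = n & ~ A n].
  have nC : ~ C (f C) by move=> [A /f_inj -> nC]; apply: (nC); exists C.
  exact: nC (ex_intro2 _ _ C erefl nC).
move=> /existsNP[x /not_implyP[_ nSx]].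
have [|m nSm mmin] := wo_min (A := ~` S); first by exists x.
apply: nSm; rewrite /S /=.
apply: (@sub_countable _ _ _ (\bigcup_b (if b then S else [set m]))).
  apply: subset_card_le => y ym.
  have [Sy|/mmin my] := pselect (S y); first by exists true.
  by exists false => //; apply: wo_anti; rewrite ym my.
by apply: bigcup_countable => // -[] _ //; exact: countable1.
Qed.

End Omega1.

Definition set_ideal {X : Type} (I : set (set X)) : Prop :=
  [/\ forall A B, A `<=` B -> I B -> I A,
      forall A B, I A -> I B -> I (A `|` B) &
      forall A, finite_set A -> I A].

Definition P_ideal {X : Type} (I : set (set X)) : Prop :=
  [/\ set_ideal I, forall A, I A -> countable A &
      forall A : nat -> set X, (forall n, I (A n)) ->
        exists2 B, I B & forall n, finite_set (A n `\` B)].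

Definition PID : Prop :=
  forall (X : Type) (I : set (set X)), P_ideal I ->
    (exists Y : set X, ~ countable Y /\
       forall A, A `<=` Y -> countable A -> I A) \/
    (exists2 Y : nat -> set X, [set: X] = \bigcup_n Y n &
       forall n A, A `<=` Y n -> countable A -> infinite_set A -> ~ I A).

Definition lt_star (f g : nat -> nat) : Prop :=
  \forall n \near \oo, (f n < g n)%N.

Definition unbounded_family (F : set (nat -> nat)) : Prop :=
  ~ exists g, forall f, F f -> lt_star f g.

Definition frakb : set (nat -> nat) := least_card unbounded_family.

Definition ideal_on_omega (I : set (set nat)) : Prop := set_ideal I /\ ~ I setT.

Definition tall (I : set (set nat)) : Prop :=
  forall A, infinite_set A -> exists B, [/\ B `<=` A, infinite_set B & I B].

(* The topology of P(omega) is that of the Cantor space, via characteristic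
   functions. *)
Definition Fsigma_family (I : set (set nat)) : Prop :=
  Fsigma [set x : cantor_space | I [set n | x n]].

Definition cof_Fsigma : set (set nat) :=
  least_card [set X | exists I : set (set nat),
    [/\ ideal_on_omega I, tall I, Fsigma_family I, sigma_pseudobounded I &
        directed X /\ cofinal I X]].

(* Main.v *)
Require Import Defs.
From mathcomp Require Import all_boot all_order.
From mathcomp Require Import all_classical.
From mathcomp Require Import zify.
From mathcomp Require Import topology cantor borel_hierarchy.

(* (1) => (2). Let D be directed of size at most aleph_1. Since b > omega_1, the
   countable subsets of D that meet every principal initial segment in a finite
   set form a P-ideal, so by PID either [omega_1]^{<omega} is Tukey below D or D
   is sigma-pseudobounded. In the latter case an unbounded sequence u in one of
   the pseudobounded pieces would make the sets {k | u k <= x}, x in D, generate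
   a tall sigma-pseudobounded ideal; it is automatically F_sigma, because the
   closure of a pseudobounded piece stays inside the ideal, and this contradicts
   cof(F_sigma) > omega_1. So countable subsets of the pieces are bounded, which
   puts D below omega x omega_1, and the first four types are told apart by
   whether D is bounded, has a countable unbounded subset, or has a countable
   cofinal subset.

   (2) => (1). If either cardinal is omega_1 we exhibit a directed set of size
   aleph_1 that is neither below omega x omega_1 nor above [omega_1]^{<omega}: a
   cofinal subset of a tall sigma-pseudobounded ideal, or a <=*-increasing
   unbounded omega_1-sequence of monotone functions closed under maxima with
   constants, ordered pointwise. For the latter, Todorcevic's argument shows that
   every uncountable subfamily contains two distinct comparable members. *)

Set Implicit Arguments.
Unset Strict Implicit.
Unset Printing Implicit Defensive.

Import Order.TTheory.

Local Open Scope classical_set_scope.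
Local Open Scope card_scope.

(** * Cardinalities and recursion on omega1 *)

(** The working form of cardinal bounds: [u] lists the nonempty set [A] along all of [U], and [v]
    picks indices in [B]. *)
Lemma card_le_retract {T U : Type} (A : set T) (B : set U) :
  A !=set0 -> A #<= B ->
  exists (u : U -> T) (v : T -> U), (forall y, A (u y)) /\
    forall x, A x -> B (v x) /\ u (v x) = x.
Proof.
elim/Ppointed: T => T in A *; first by rewrite emptyE => -[].
move=> [a Aa] /pcard_surjP[g gBA].
pose u y := if pselect (A (g y)) then g y else a.
have /choice[v vP] x : exists y, A x -> B y /\ u y = x.
  have [Ax|nAx] := pselect (A x); last by have [y _ _] := gBA _ Aa; exists y.
  have [y By gx] := gBA _ Ax; exists y => _; split=> //; rewrite /u.
  by case: pselect => // -[]; rewrite gx.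
by exists u, v; split=> // y; rewrite /u; case: pselect.
Qed.

Lemma card_le_inj {T U : Type} (A : set T) (B : set U) (f : T -> U) :
  (forall x, A x -> B (f x)) ->
  (forall x y, A x -> A y -> f x = f y -> x = y) -> A #<= B.
Proof.
move=> fAB finj; have inj : {in A &, injective f}.
  by move=> x y /set_mem Ax /set_mem Ay; exact: finj.
have /card_eqPle[_ le_im] := inj_card_eq inj.
apply: (card_le_trans le_im); apply: subset_card_le => _ [x Ax <-]; exact: fAB.
Qed.

Lemma countable_inj {T : Type} (A : set T) : countable A ->
  exists f : T -> nat, forall x y, A x -> A y -> f x = f y -> x = y.
Proof.
move=> /countable_injP[f finj]; exists f => x y Ax Ay.
by apply: finj; exact: mem_set.
Qed.

Lemma countable_image {T U : Type} (f : T -> U) (A : set T) :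
  countable A -> countable (f @` A).
Proof. exact/card_le_trans/card_image_le. Qed.

Lemma countable_sub {T : Type} (A B : set T) :
  A `<=` B -> countable B -> countable A.
Proof. by move=> /subset_card_le; exact: card_le_trans. Qed.

Lemma countable_setU {T : Type} (A B : set T) :
  countable A -> countable B -> countable (A `|` B).
Proof.
move=> cA cB; apply: (@countable_sub _ _ (\bigcup_b (if b then A else B))).
  by move=> x [Ax|Bx]; [exists true|exists false].
by apply: bigcup_countable => // -[].
Qed.

Lemma uncountableD {T : Type} (A B : set T) :
  ~ countable A -> countable B -> ~ countable (A `\` B).
Proof.
move=> nA cB cAB; apply: nA.
apply: countable_sub (countable_setU cAB cB) => x Ax.
by have [Bx|nBx] := pselect (B x); [right|left].
Qed.

Lemma uncountable_neq0 {T : Type} (A : set T) : ~ countable A -> A !=set0.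
Proof. by move=> nA; apply/set0P/eqP => A0; apply: nA; rewrite A0. Qed.

Lemma uncountable_infinite {T : Type} (A : set T) :
  ~ countable A -> infinite_set A.
Proof. by move=> nA fA; apply: nA; exact: finite_set_countable. Qed.

Lemma uncountable_bigcup {T : Type} (A : set T) (F : nat -> set T) :
  ~ countable A -> A `<=` \bigcup_n F n -> exists n, ~ countable (A `&` F n).
Proof.
move=> nA AF; apply: contrapT => cF; apply: nA.
apply: (@countable_sub _ _ (\bigcup_n (A `&` F n))).
  by move=> x Ax; have [n _ Fx] := AF _ Ax; exists n.
apply: bigcup_countable => // n _; apply: contrapT => nc.
by apply: cF; exists n.
Qed.

Lemma infinite_seq {T : Type} (A : set T) : infinite_set A ->
  exists s : nat -> T, injective s /\ forall n, A (s n).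
Proof.
move=> /infiniteP/card_le_retract-/(_ (ex_intro _ 0 I))[p [s [_ sP]]].
exists s; split=> [m n /(congr1 p)|n]; last by case: (sP n I).
by have [_ ->] := sP m I; have [_ ->] := sP n I.
Qed.

Lemma infinite_countable_sub {T : Type} (A : set T) : infinite_set A ->
  exists B, [/\ B `<=` A, infinite_set B & countable B].
Proof.
move=> /infinite_seq[s [sinj sA]]; exists (range s); split.
- by move=> _ [n _ <-].
- apply/infiniteP; apply: (card_le_inj (f := s)) => [n _|m n _ _ /sinj//].
  by exists n.
- exact: card_image_le.
Qed.

Lemma infinite_nat_unbounded (A : set nat) :
  infinite_set A -> forall n, exists2 k, A k & n <= k.
Proof.
move=> Ainf n; apply: contrapT => nA; apply: Ainf.
apply: sub_finite_set (finite_II n) => k Ak /=.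
by rewrite ltnNge; apply/negP => nk; apply: nA; exists k.
Qed.

Lemma unbounded_nat_infinite (A : set nat) :
  (forall n, exists2 k, A k & n <= k) -> infinite_set A.
Proof.
move=> Aub Afin.
suff [n An] : exists n, forall k, A k -> k < n.
  by have [k /An kn] := Aub n; rewrite leqNgt kn.
have [s sE] : exists s : seq nat, A = [set` s] by exact/finite_seqP.
exists (\max_(k <- s) k).+1 => k; rewrite sE /= => ks.
by rewrite ltnS; exact: leq_bigmax_seq.
Qed.

Lemma finite_nat_bound (A : set nat) :
  finite_set A -> exists n, forall k, A k -> k <= n.
Proof.
move=> fA; apply: contrapT => nA; apply: (@unbounded_nat_infinite A) fA => n.
apply: contrapT => nk; apply: nA; exists n => k Ak.
by rewrite leqNgt; apply/negP => /ltnW kn; apply: nk; exists k.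
Qed.

Lemma omega1_lt_wf : well_founded (fun x y : omega1 => (x < y)%O).
Proof.
move=> x; apply: contrapT => nacc.
pose lt (x y : omega1) := (x < y)%O.
have [|m nm mmin] := @omega1_well_founded [set y | ~ Acc lt y]; first by exists x.
apply: nm; constructor => y ym; apply: contrapT => /mmin.
by rewrite leNgt (ym : (y < m)%O).
Qed.

(** Steps are given by a relation, so an application only has to show that a next value exists.
    Since [R a] depends on [h] only below [a], the filler [t0] is harmless. *)
Lemma omega1_rec (T : Type) (t0 : T) (R : omega1 -> (omega1 -> T) -> T -> Prop) :
  (forall a h, exists y, R a h y) ->
  (forall a h h' y, (forall b, (b < a)%O -> h b = h' b) -> R a h y -> R a h' y) ->
  exists f, forall a, R a f (f a).
Proof.
move=> Rex Rext.
have /choice[g gP] (p : omega1 * (omega1 -> T)) : exists y, R p.1 p.2 y by [].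
pose F a (h : forall b, (b < a)%O -> T) : T :=
  g (a, fun b => if pselect (b < a)%O is left ba then h b ba else t0).
have FE a (h h' : forall b, (b < a)%O -> T) :
    (forall b ba, h b ba = h' b ba) -> F a h = F a h'.
  move=> hh'; rewrite /F; congr (g (_, _)); apply/funext => b.
  by case: pselect.
pose f := Fix omega1_lt_wf (fun=> T) F.
exists f => a; rewrite /f Fix_eq // -/f /F.
apply: Rext (gP (a, _)) => b ba /=.
by case: pselect.
Qed.

Lemma omega1_lt_countable (a : omega1) : countable [set b | (b < a)%O].
Proof.
by apply: countable_sub (omega1_initial_countable a) => b /ltW.
Qed.

Lemma omega1_countable_bound (A : set omega1) : countable A ->
  exists a, forall b, A b -> (b < a)%O.
Proof.
move=> cA.
have nc : ~ countable [set: omega1] := @omega1_uncountable.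
have cU : countable (\bigcup_(b in A) [set c | (c <= b)%O]).
  by apply: bigcup_countable => // b _; exact: omega1_initial_countable.
have [a [_ na]] := uncountable_neq0 (uncountableD nc cU).
exists a => b Ab; rewrite ltNge; apply/negP => ab.
by apply: na; exists b.
Qed.

Lemma uncountable_omega1_inj {T : Type} (A : set T) : ~ countable A ->
  exists f : omega1 -> T, injective f /\ forall a, A (f a).
Proof.
move=> nA; have [t0 _] := uncountable_neq0 nA.
have [||f fP] := @omega1_rec T t0
    (fun a h y => A y /\ forall b, (b < a)%O -> h b <> y).
- move=> a h; have ch := countable_image h (@omega1_lt_countable a).
  have [y [Ay ny]] := uncountable_neq0 (uncountableD nA ch).
  by exists y; split=> // b ba hb; apply: ny; exists b.
- by move=> a h h' y hh' [Ay hy]; split=> // b ba; rewrite -hh' //; exact: hy.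
exists f; split=> [a b fab|a]; last by have [] := fP a.
case: (ltgtP a b) => // [ab|ba].
  by have [_ /(_ _ ab)] := fP b.
by have [_ /(_ _ ba)[]] := fP a.
Qed.

Lemma uncountable_ge_omega1 {T : Type} (A : set T) :
  ~ countable A -> [set: omega1] #<= A.
Proof.
move=> /uncountable_omega1_inj[f [finj fA]].
by apply: (card_le_inj (f := f)) => [a _|a b _ _ /finj].
Qed.

Lemma uncountable_of_not_le {T : Type} (A : set T) :
  ~ (A #<= [set: omega1]) -> ~ countable A.
Proof.
move=> nA cA; apply: nA; apply: (card_le_trans cA).
apply/infiniteP/uncountable_infinite; exact: omega1_uncountable.
Qed.

(** Each [a] receives an injective sequence avoiding the countably many values used before. *)
Lemma card_omega1_nat : [set: omega1 * nat] #<= [set: omega1].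
Proof.
have [a0 _] := uncountable_neq0 (@omega1_uncountable).
have [||f fP] := @omega1_rec (nat -> omega1) (fun=> a0)
    (fun a h y => injective y /\ forall b, (b < a)%O -> forall m n, h b m <> y n).
- move=> a h.
  have cU : countable (\bigcup_(b in [set b | (b < a)%O]) range (h b)).
    apply: bigcup_countable => [|b _]; first exact: omega1_lt_countable.
    exact: card_image_le.
  have /uncountable_infinite/infinite_seq[s [sinj sP]] :=
    uncountableD (@omega1_uncountable) cU.
  exists s; split=> // b ba m n hs; have [_ []] := sP n.
  by exists b => //; exists m.
- by move=> a h h' y hh' [yi hy]; split=> // b ba; rewrite -hh' //; exact: hy.
apply: (card_le_inj (f := fun p => f p.1 p.2)) => // -[a m] [b n] _ _ /= fab.
case: (ltgtP a b) fab => [ab|ba|->].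
- by have [_ /(_ _ ab)] := fP b => h /h.
- by have [_ /(_ _ ba)] := fP a => h /esym/h.
- by have [finj _] := fP b => /finj ->.
Qed.

Lemma infinite_image {T U : Type} (f : T -> U) (A : set T) :
  (forall x y, A x -> A y -> f x = f y -> x = y) ->
  infinite_set A -> infinite_set (f @` A).
Proof.
move=> finj Ainf fAfin; apply: Ainf; apply: card_le_finite fAfin.
by apply: (card_le_inj (f := f)) => [x Ax|]; first exists x.
Qed.

Lemma infinite_fiber {T U : Type} (A : set T) (f : T -> U) :
  infinite_set A -> finite_set (f @` A) ->
  exists y, infinite_set (A `&` f @^-1` [set y]).
Proof.
move=> Ainf fAfin; apply: contrapT => ny; apply: Ainf.
apply: (@sub_finite_set _ _ (\bigcup_(y in f @` A) (A `&` f @^-1` [set y]))).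
  by move=> x Ax; exists (f x); [exists x|split].
apply: bigcup_finite => // y _; apply: contrapT => yinf; apply: ny.
by exists y.
Qed.

(** * Layered directed sets *)

Section Directed.
Context {d : Order.disp_t} {T : porderType d}.
Implicit Types (D A B : set T).

Lemma directed_finite_bounded D A :
  directed D -> A `<=` D -> finite_set A -> bounded_in D A.
Proof.
move=> [[x0 Dx0] Ddir] AD /finite_seqP[s sE].
have {AD} : forall x, x \in s -> D x by move=> x xs; apply: AD; rewrite sE.
rewrite {}sE; elim: s => [|x s IHs] sD; first by exists x0; split=> // y.
have [|z [Dz zs]] := IHs; first by move=> y ys; apply: sD; rewrite inE ys orbT.
have [|w [Dw xw zw]] := Ddir x z _ Dz; first by apply: sD; rewrite inE eqxx.
exists w; split=> // y /=; rewrite inE => /orP[/eqP->//|ys].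
exact: le_trans (zs _ ys) zw.
Qed.

(* Among directed sets of size at most aleph_1, this is the intrinsic form of
   being Tukey below nat *p omega1, see tukey_le_layered and layered_tukey_le. *)
Definition layered D : Prop := exists r : T -> nat, forall n A,
  A `<=` D -> countable A -> (forall x, A x -> r x <= n) -> bounded_in D A.

End Directed.

Section TukeyReductions.
Context {d d' : Order.disp_t} {T : porderType d} {U : porderType d'}.
Implicit Types (D : set T) (E : set U).

Lemma tukey_leI D E (f : T -> U) : (forall x, D x -> E (f x)) ->
  (forall A y, A `<=` D -> E y -> (forall x, A x -> (f x <= y)%O) ->
    bounded_in D A) -> tukey_le D E.
Proof.
move=> fDE fb; exists f => // A AD nA [y [Ey yA]]; apply: nA.
by apply: (fb _ y) => // x Ax; apply: yA; exists x.
Qed.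

Lemma tukey_leE D E : tukey_le D E ->
  exists f : T -> U, (forall x, D x -> E (f x)) /\
    forall A, A `<=` D -> bounded_in E (f @` A) -> bounded_in D A.
Proof.
by move=> [f fDE fb]; exists f; split=> // A AD bA; apply: contrapT => /fb; exact.
Qed.

Lemma tukey_le_layered D E : tukey_le D E -> layered E -> layered D.
Proof.
move=> /tukey_leE[f [fDE fb]] [r rP]; exists (r \o f) => n A AD cA rA.
apply: fb => //; apply: (rP n); last by move=> _ [x Ax <-]; exact: rA.
- by move=> _ [x /AD/fDE Efx <-].
- exact: countable_image.
Qed.

End TukeyReductions.

Lemma layered_max {d} {T : porderType d} (D : set T) x :
  D x -> (forall y, D y -> (y <= x)%O) -> layered D.
Proof.
move=> Dx xD; exists (fun=> 0) => n A AD _ _; exists x; split=> // y /AD.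
exact: xD.
Qed.

Lemma layered_nat : layered [set: nat].
Proof. by exists id => n A _ _ An; exists n; split=> // x /An. Qed.

Lemma layered_omega1 : layered [set: omega1].
Proof.
exists (fun=> 0) => _ A _ /omega1_countable_bound[a aA] _.
by exists a; split=> // x /aA/ltW.
Qed.

Lemma layered_nat_omega1 : layered [set: nat *p omega1].
Proof.
exists (fun p => p.1) => n A _ cA An.
have [a aA] := omega1_countable_bound (countable_image (fun p => p.2) cA).
exists (n, a); split=> // p Ap; rewrite leEprod /=; apply/andP; split.
  exact: An.
by apply/ltW/aA; exists p.
Qed.

(** * Tukey comparison with the finite subsets of [omega1] *)

Section FiniteSubsets.
Context {d : Order.disp_t} {T : porderType d}.
Variable D : set T.
Hypothesis Ddir : directed D.

Lemma tukey_le_finite_subsets : D #<= [set: omega1] ->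
  tukey_le D [set A : set omega1 | finite_set A].
Proof.
move=> Dle; have [u [v [uD vP]]] := card_le_retract (proj1 Ddir) Dle.
apply: (tukey_leI (f := fun x => [set v x])) => [x _|A F AD Ffin AF].
  exact: finite_set1.
apply: directed_finite_bounded => //; apply: sub_finite_set (finite_image u Ffin).
move=> x Ax; exists (v x); last by have [] := vP _ (AD _ Ax).
by have := AF _ Ax; rewrite subsetEset; apply.
Qed.

(** A finite [F] is sent to a bound of its image under [e]. With the converse below, such families
    [e] become the working form of being Tukey above the finite subsets of [omega1]. *)
Lemma finite_subsets_tukey_le (e : omega1 -> T) : (forall a, D (e a)) ->
  (forall x, D x -> finite_set [set a | (e a <= x)%O]) ->
  tukey_le [set A : set omega1 | finite_set A] D.
Proof.
move=> eD efin.
have /choice[f fP] (F : set omega1) :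
    exists x, finite_set F -> D x /\ forall a, F a -> (e a <= x)%O.
  have [fF|nF] := pselect (finite_set F); last by have [x _] := proj1 Ddir; exists x.
  have [||x [Dx xF]] := @directed_finite_bounded _ _ _ (e @` F) Ddir.
  - by move=> _ [a _ <-].
  - exact: finite_image.
  - by exists x => _; split=> // a Fa; apply: xF; exists a.
apply: (tukey_leI (f := f)) => [F /fP[]//|A x AF Dx Ax].
exists [set a | (e a <= x)%O]; split; first exact: efin.
move=> F AFF; rewrite subsetEset => a Fa /=.
by apply: le_trans (Ax _ AFF); have [_] := fP _ (AF _ AFF); apply.
Qed.

Lemma finite_subsets_tukey_leE :
  tukey_le [set A : set omega1 | finite_set A] D ->
  exists e : omega1 -> T, (forall a, D (e a)) /\
    forall x, D x -> finite_set [set a | (e a <= x)%O].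
Proof.
move=> /tukey_leE[f [fD fb]]; exists (fun a => f [set a]); split=> [a|x Dx].
  by apply: fD; exact: finite_set1.
have [||F [Ffin FA]] := fb [set [set a] | a in [set a | (f [set a] <= x)%O]].
- by move=> _ [a _ <-]; exact: finite_set1.
- by exists x; split=> // _ [_ [a ax <-] <-].
apply: sub_finite_set Ffin => a ax.
have : ([set a] <= F)%O by apply: FA; exists a.
by rewrite subsetEset; apply.
Qed.

End FiniteSubsets.

(** * Cofinal types of layered directed sets *)

Section Classification.
Context {d : Order.disp_t} {T : porderType d}.
Variable D : set T.
Hypotheses (Ddir : directed D) (Dle : D #<= [set: omega1]).

Definition countably_cofinal := exists C, [/\ C `<=` D, countable C & cofinal D C].

Lemma max_tukey_equiv1 x : D x -> (forall y, D y -> (y <= x)%O) ->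
  tukey_equiv D [set: 'I_1].
Proof.
move=> Dx xD; split.
  apply: (tukey_leI (f := fun=> ord0)) => // A y AD _ _.
  by exists x; split=> // z /AD; exact: xD.
apply: (tukey_leI (f := fun=> x)) => // A y _ _ _.
by exists ord0; split=> // i _; rewrite ord1.
Qed.

Lemma countably_cofinal_tukey_le : countably_cofinal -> tukey_le D [set: nat].
Proof.
move=> [C [CD cC [_ Ccof]]].
have C0 : C !=set0.
  by have [x /Ccof[y Cy _]] := proj1 Ddir; exists y.
have [h [k [hC kP]]] := card_le_retract C0 cC.
have /choice[f fP] x : exists n, D x -> (x <= h n)%O.
  have [Dx|nDx] := pselect (D x); last by exists 0.
  have [y Cy xy] := Ccof _ Dx; exists (k y) => _.
  by have [_ ->] := kP _ Cy.
apply: (tukey_leI (f := f)) => // A n AD _ An.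
have [||x [Dx xh]] := @directed_finite_bounded _ _ _ (h @` `I_n.+1) Ddir.
- by move=> _ [i _ <-]; exact: CD.
- exact/finite_image/finite_II.
exists x; split=> // y Ay; apply: le_trans (fP _ (AD _ Ay)) _.
by apply: xh; exists (f y) => //; rewrite /= ltnS; exact: An.
Qed.

(** [g n] bounds the first [n.+1] terms of an enumeration of [C], so a bound for [g] on infinitely
    many indices would bound [C]. *)
Lemma unbounded_tukey_ge C : C `<=` D -> countable C -> ~ bounded_in D C ->
  tukey_le [set: nat] D.
Proof.
move=> CD cC nC.
have C0 : C !=set0.
  apply/set0P/eqP => C0; apply: nC; have [x Dx] := proj1 Ddir.
  by exists x; split=> // y; rewrite C0.
have [h [v [hC vP]]] := card_le_retract C0 cC.
have /choice[g gP] n : exists x, D x /\ forall k, k <= n -> (h k <= x)%O.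
  have [||x [Dx xh]] := @directed_finite_bounded _ _ _ (h @` `I_n.+1) Ddir.
  - by move=> _ [k _ <-]; exact: CD.
  - exact/finite_image/finite_II.
  by exists x; split=> // k kn; apply: xh; exists k.
apply: (tukey_leI (f := g)) => [n _|A x _ Dx Ax]; first by have [] := gP n.
have [fA|infA] := pselect (finite_set A).
  by have [n An] := finite_nat_bound fA; exists n; split.
case: nC; exists x; split=> // y /vP[_ <-].
have [n An kn] := infinite_nat_unbounded infA (v y).
by apply: le_trans (Ax _ An); have [_] := gP n; apply.
Qed.

(** [u] lists [D] along [omega1], and [g a] is chosen below no [u b] with [b <= a]; hence
    [g a <= u b] forces [a < b]. *)
Lemma uncofinal_tukey_ge : ~ countably_cofinal -> tukey_le [set: omega1] D.
Proof.
move=> nD; have [u [v [uD vP]]] := card_le_retract (proj1 Ddir) Dle.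
have /choice[g gP] a : exists x, D x /\ forall b, (b <= a)%O -> ~~ (x <= u b)%O.
  apply: contrapT => na; apply: nD.
  have CD : u @` [set b | (b <= a)%O] `<=` D by move=> _ [b _ <-].
  exists (u @` [set b | (b <= a)%O]); split=> //.
    by apply: countable_image; exact: omega1_initial_countable.
  split=> // y Dy; apply: contrapT => ny; apply: na; exists y; split=> // b ba.
  by apply/negP => yb; apply: ny; exists (u b) => //; exists b.
apply: (tukey_leI (f := g)) => [a _|A x _ Dx Ax]; first by have [] := gP a.
exists (v x); split=> // a Aa.
rewrite leNgt; apply/negP => /ltW xa; have [_ /(_ _ xa)] := gP a.
by have [_ ->] := vP _ Dx; rewrite Ax.
Qed.

Lemma layered_tukey_le : layered D -> tukey_le D [set: nat *p omega1].
Proof.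
move=> [r rP]; have [u [v [uD vP]]] := card_le_retract (proj1 Ddir) Dle.
apply: (tukey_leI (f := fun x => (r x, v x) : nat *p omega1)) => //.
move=> A [n a] AD _ Ana; apply: (rP n) => // [|x Ax]; last first.
  by have := Ana _ Ax; rewrite leEprod /= => /andP[].
apply: countable_sub (countable_image u (@omega1_initial_countable a)) => x Ax.
exists (v x); last by have [] := vP _ (AD _ Ax).
by have := Ana _ Ax; rewrite leEprod /= => /andP[].
Qed.

Lemma layered_tukey_equiv : layered D ->
  [\/ tukey_equiv D [set: 'I_1], tukey_equiv D [set: nat],
      tukey_equiv D [set: omega1] | tukey_equiv D [set: nat *p omega1]].
Proof.
move=> Dlay; have [cofD|ncofD] := pselect countably_cofinal.
  have [bD|nbD] := pselect (bounded_in D D).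
    by have [x [Dx xD]] := bD; constructor 1; exact: (max_tukey_equiv1 Dx).
  constructor 2; split; first exact: countably_cofinal_tukey_le.
  have [C [CD cC [_ Ccof]]] := cofD.
  apply: (unbounded_tukey_ge CD cC) => -[x [Dx xC]]; apply: nbD.
  exists x; split=> // y /Ccof[z Cz yz]; exact: le_trans yz (xC _ Cz).
have leD := uncofinal_tukey_ge ncofD.
(* With a countable unbounded set, both [nat] and [omega1] lie below [D], and joint bounds map their
   product into [D]. Without one, [v] reduces [D] to [omega1], because a bounded set of indices is
   countable. *)
have [[C [CD cC nC]]|bC] :=
    pselect (exists C, [/\ C `<=` D, countable C & ~ bounded_in D C]).
  constructor 4; split; first exact: layered_tukey_le.
  have /tukey_leE[h [hD hb]] := unbounded_tukey_ge CD cC nC.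
  have /tukey_leE[g [gD gb]] := leD.
  have /choice[f fP] (p : nat * omega1) :
      exists x, [/\ D x, (h p.1 <= x)%O & (g p.2 <= x)%O].
    by case: Ddir => _; apply; [exact: hD|exact: gD].
  apply: (tukey_leI (f := f : nat *p omega1 -> T)) => [p _|A x _ Dx Ax].
    by have [] := fP p.
  have [||n [_ nA]] := hb [set p.1 | p in A] => //.
    exists x; split=> // _ [_ [p Ap <-] <-].
    by apply: le_trans (Ax _ Ap); have [] := fP p.
  have [||a [_ aA]] := gb [set p.2 | p in A] => //.
    exists x; split=> // _ [_ [p Ap <-] <-].
    by apply: le_trans (Ax _ Ap); have [] := fP p.
  exists (n, a); split=> // p Ap; rewrite leEprod; apply/andP; split.
    by apply: nA; exists p.
  by apply: aA; exists p.
constructor 3; split=> //.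
have [u [v [uD vP]]] := card_le_retract (proj1 Ddir) Dle.
apply: (tukey_leI (f := v)) => // A a AD _ Aa.
apply: contrapT => nA; apply: bC; exists A; split=> //.
apply: countable_sub (countable_image u (@omega1_initial_countable a)) => x Ax.
by exists (v x); [exact: Aa|have [] := vP _ (AD _ Ax)].
Qed.

End Classification.

(** * Pseudobounded sets *)

Section Pseudobounded.
Context {d : Order.disp_t} {T : porderType d}.
Implicit Types (D X : set T).

(** If [e] takes infinitely many values, pseudoboundedness applies to them; otherwise one value is
    taken infinitely often and is its own bound. *)
Lemma pseudobounded_family {U : Type} D X (K : set U) (e : U -> T) :
  pseudobounded D X -> infinite_set K -> (forall k, K k -> X (e k)) ->
  exists2 y, D y & infinite_set (K `&` [set k | (e k <= y)%O]).
Proof.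
move=> [XD Xpb] /infinite_countable_sub[L [LK Linf cL]] eX.
have {}eX k : L k -> X (e k) by move=> /LK/eX.
suff [y Dy yinf] : exists2 y, D y & infinite_set (L `&` [set k | (e k <= y)%O]).
  by exists y => //; apply: sub_infinite_set yinf; exact: setSI.
have [efin|einf] := pselect (finite_set (e @` L)); last first.
  have [||B [BL Binf [y [Dy yB]]]] := Xpb _ _ einf.
  - by move=> _ [k /eX Xk <-].
  - exact: countable_image.
  exists y => // yfin; apply: Binf; apply: sub_finite_set (finite_image e yfin).
  move=> x Bx; have [k Lk ek] := BL _ Bx; exists k => //.
  by split=> //=; rewrite ek; exact: yB.
have [y yinf] := infinite_fiber Linf efin.
have [k [Lk ky]] := infinite_setN0 yinf.
exists y; first by rewrite -ky; exact/XD/eX.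
by apply: sub_infinite_set yinf => j [Lj /= <-]; split=> /=.
Qed.

(** Uncountably many indices [a] would put [e a] in one piece, where infinitely many share a bound
    in [D], hence one in the cofinal set [X]. *)
Lemma sigma_pseudobounded_not_tukey_ge D X :
  sigma_pseudobounded D -> cofinal D X ->
  ~ tukey_le [set A : set omega1 | finite_set A] X.
Proof.
move=> [Y Ypb DE] [XD Xcof] /finite_subsets_tukey_leE[e [eX efin]].
have [|n nc] := @uncountable_bigcup _ _ (fun n => e @^-1` Y n) (@omega1_uncountable).
  by move=> a _; have := XD _ (eX a); rewrite DE => -[n _ Yn]; exists n.
have [|y Dy yinf] := pseudobounded_family (e := e) (Ypb n) (uncountable_infinite nc).
  by move=> a [].
have [x Xx yx] := Xcof _ Dy.
apply: yinf; apply: sub_finite_set (efin _ Xx) => a [_ /= ay].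
exact: le_trans ay yx.
Qed.

End Pseudobounded.

Section FamiliesOnNat.
Implicit Types (I : set (set nat)).

Lemma cantor_prefix_nbhs (x : cantor_space) n :
  nbhs x [set y : cantor_space | forall i, i < n -> y i = x i].
Proof.
elim: n => [|n IHn]; first by apply: filterS filterT => y _ i.
have xn : nbhs x [set y : cantor_space | y n = x n].
  have /(_ [set x n]) := @proj_continuous nat (fun=> bool) n x; apply.
  exact: discrete_set1.
apply: filterS (filterI IHn xn) => y [yx yn] i.
by rewrite ltnS leq_eqVlt => /orP[/eqP->|/yx].
Qed.

(** [I] is the union of the closures of its pieces. A point of such a closure agrees below [k] with
    some [y k] in the piece; infinitely many [y k] lie in one member of [I], which then contains the
    limit. *)
Lemma sigma_pseudobounded_Fsigma I : (forall A B, A `<=` B -> I B -> I A) ->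
  sigma_pseudobounded I -> Fsigma_family I.
Proof.
move=> Isub [X Xpb IE].
pose S n := [set x : cantor_space | X n [set i | x i]].
exists (fun n => closure (S n)) => [n|]; first exact: closed_closure.
apply/seteqP; split=> [x|x [n _ xS]] /=.
  by rewrite IE => -[n _ Xn]; exists n => //; exact: subset_closure.
have /choice[y yP] k : exists y : cantor_space, S n y /\ forall i, i < k -> y i = x i.
  by have [y [Sy yx]] := xS _ (cantor_prefix_nbhs x k); exists y.
have [|Z IZ Zinf] := pseudobounded_family (e := fun k => [set i | y k i])
    (Xpb n) infinite_nat.
  by move=> k _; have [] := yP k.
apply: Isub IZ => i xi; have [k [_ /= kZ] ik] := infinite_nat_unbounded Zinf i.+1.
move: kZ; rewrite subsetEset; apply => /=.
by have [_ ->] := yP k.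
Qed.

End FamiliesOnNat.

(** * A tall sigma-pseudobounded ideal *)

Section SlowSets.
Implicit Types (A B : set nat).

Definition count_below A n := \sum_(i < n) `[<A i>] : nat.

(* The factor m.+2 between the bounds for n and n.+1 is what makes slow_sets n
   pseudobounded: if the i-th set of a sequence in slow_sets n agrees with the
   limit below growth i, then at most m.+1 of the sets matter below growth m.
   The exponent m.+1 keeps setT out of the ideal. *)
Definition growth m := m.+2 ^ m.+1.

Definition slow_sets n : set (set nat) :=
  [set A | forall m, count_below A (growth m) <= m.+2 ^ n].

Definition slow_ideal : set (set nat) := \bigcup_n slow_sets n.

Lemma count_below_sub A B n :
  (forall i, i < n -> A i -> B i) -> count_below A n <= count_below B n.
Proof.
move=> AB; apply: leq_sum => i _.
by case: asboolP => // Ai; case: asboolP => // -[]; exact: AB.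
Qed.

Lemma count_below_bigcup (A : nat -> set nat) k n :
  count_below (\bigcup_(i in `I_k) A i) n <= \sum_(i < k) count_below (A i) n.
Proof.
rewrite exchange_big; apply: leq_sum => i _.
case: asboolP => // -[j /= jk Aji].
by rewrite (bigD1 (Ordinal jk)) //=; case: asboolP.
Qed.

Lemma count_below_image (b : nat -> nat) k A n :
  (forall i, i < n -> A i -> exists2 j, j < k & b j = i) -> count_below A n <= k.
Proof.
move=> Ab; apply: (@leq_trans (\sum_(j < k) count_below [set b j] n)).
  apply: leq_trans (count_below_bigcup (fun j => [set b j]) k n).
  by apply: count_below_sub => i ik /(Ab _ ik)[j jk <-]; exists j.
rewrite -[leqRHS]card_ord -sum1_card; apply: leq_sum => j _.
have [bn|nb] := ltnP (b j) n.
  rewrite /count_below (bigD1 (Ordinal bn)) //= big1 => [|i ib].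
    by rewrite addn0; case: asboolP.
  by case: asboolP => // ibj; case/eqP: ib; exact: val_inj.
rewrite /count_below big1 // => i _.
by case: asboolP => // ibj; move: nb; rewrite -ibj leqNgt ltn_ord.
Qed.

Lemma leq_growth m : m <= growth m.
Proof.
apply: (@leq_trans m.+2); first by rewrite leqW.
by rewrite /growth expnS leq_pmulr // expn_gt0.
Qed.

Lemma growth_mono m n : m <= n -> growth m <= growth n.
Proof.
move=> mn; apply: (@leq_trans (n.+2 ^ m.+1)); first by rewrite leq_exp2r.
by rewrite leq_exp2l.
Qed.

Lemma slow_ideal_sub A B : A `<=` B -> slow_ideal B -> slow_ideal A.
Proof.
move=> AB [n _ Bn]; exists n => // m; apply: leq_trans (Bn m).
by apply: count_below_sub => i _; exact: AB.
Qed.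

Lemma slow_ideal_ideal : ideal_on_omega slow_ideal.
Proof.
split; last first.
  move=> [n _ /(_ n)].
  rewrite /count_below (eq_bigr (fun=> 1)) => [|i _]; last by case: asboolP => // -[].
  by rewrite sum1_card card_ord /growth leq_exp2l // ltnn.
split=> [A B|A B [a _ Aa] [b _ Bb]|A /finite_nat_bound[n An]].
- exact: slow_ideal_sub.
- exists (maxn a b).+1 => // m; rewrite expnS mulSn.
  apply: (@leq_trans (m.+2 ^ a + m.+2 ^ b)).
    apply: leq_trans (leq_add (Aa m) (Bb m)).
    rewrite /count_below -big_split; apply: leq_sum => i _ /=.
    by case: asboolP => // -[] h; case: asboolP => // _; case: asboolP.
  apply: leq_add; first by rewrite leq_exp2l // leq_maxl.
  apply: leq_trans (leq_pmull _ _) => //.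
  by rewrite leq_exp2l // leq_maxr.
- exists n.+1 => // m; apply: (@leq_trans n.+1).
    by apply: (count_below_image (b := id)) => i _ /An; exists i.
  apply: (@leq_trans (2 ^ n.+1)); last by rewrite leq_exp2r.
  exact/ltnW/ltn_expl.
Qed.

(** Points [b n] of [A] with [growth n <= b n] leave at most [m] elements below [growth m]. *)
Lemma slow_ideal_tall : tall slow_ideal.
Proof.
move=> A Ainf.
have /choice[b bP] n : exists k, A k /\ growth n <= k.
  by have [k Ak nk] := infinite_nat_unbounded Ainf (growth n); exists k.
exists (range b); split.
- by move=> _ [n _ <-]; have [] := bP n.
- apply: unbounded_nat_infinite => n; exists (b n); first by exists n.
  by apply: leq_trans (leq_growth n) _; have [] := bP n.
- exists 1 => // m; rewrite expn1; apply: leq_trans (leqW (leqnSn m)).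
  apply: (count_below_image (b := b)) => i im [j _ bj]; exists j => //.
  have [_ jb] := bP j; rewrite ltnNge; apply/negP => /growth_mono mj.
  by move: im; rewrite -bj ltnNge (leq_trans mj jb).
Qed.

(** Compactness of the Cantor space: [G m] is an infinite part of [F] on which membership of every
    [k < m] is decided, and [L] records the decisions. *)
Lemma exists_accumulation (F : set (set nat)) : infinite_set F ->
  exists L : set nat, forall m,
    infinite_set (F `&` [set B | forall k, k < m -> (B k <-> L k)]).
Proof.
move=> Finf.
pose G := fix G m : set (set nat) := if m is k.+1 then
  let H := G k `&` [set B | B k] in
  if pselect (infinite_set H) then H else G k `\` H else F.
have Ginf m : infinite_set (G m).
  elim: m => //= m IHm; case: pselect => // nH.
  by apply: infinite_setD IHm _; exact: contrapT.
pose L := [set k | infinite_set (G k `&` [set B | B k])].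
exists L => m; apply: sub_infinite_set (Ginf m).
elim: m => [|m IHm] B /=; first by split.
have step : G m B -> (B m <-> L m) ->
    (F `&` [set B | forall k, k < m.+1 -> (B k <-> L k)]) B.
  move=> /IHm[FB Bm] BL; split=> // k; rewrite ltnS leq_eqVlt => /orP[/eqP->//|].
  exact: Bm.
by case: pselect => [H [GB Bm]|nH [GB nB]]; apply: step => //; split=> // Bm; case: nB.
Qed.

Lemma slow_ideal_sigma_pseudobounded : sigma_pseudobounded slow_ideal.
Proof.
exists slow_sets => // n; split=> [A An|F Fn Finf _]; first by exists n.
have [L LP] := exists_accumulation Finf.
(* Excluding [L] keeps the range of [B] infinite: a set attained for infinitely many [m] would agree
   with [L] everywhere. *)
have /choice[B BP] m : exists B, [/\ F B, B <> L &
    forall k, k < growth m -> (B k <-> L k)].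
  have [B [[FB BL] nB]] := infinite_setN0 (infinite_setD (LP (growth m)) (finite_set1 L)).
  by exists B; split=> // /nB.
exists (range B); split.
- by move=> _ [m _ <-]; have [] := BP m.
- move=> Bfin; have [C] := infinite_fiber infinite_nat Bfin; rewrite setTI => Cinf.
  have [m /= BmC] := infinite_setN0 Cinf.
  have [_ CL _] := BP m; apply: CL; apply/seteqP.
  have agree k : (B m k <-> L k).
    rewrite BmC; have [i <- ki] := infinite_nat_unbounded Cinf k.+1.
    have [_ _] := BP i; apply; exact: leq_trans ki (leq_growth i).
  by split=> k /agree.
- exists (\bigcup_i B i); split; last first.
    by move=> _ [i _ <-]; rewrite subsetEset => k Bk; exists i.
  (* Below [growth m] every [B i] with [i > m] coincides with [B m], so [m.+1] sets make up the
     whole union. *)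
  exists n.+1 => // m; apply: (@leq_trans (\sum_(i < m.+1) count_below (B i) (growth m))).
    apply: leq_trans (count_below_bigcup B m.+1 (growth m)).
    apply: count_below_sub => k kg [i _ Bik].
    have [im|mi] := leqP i m; first by exists i.
    exists m => //=; have [_ _ /(_ _ kg)->] := BP m.
    have [_ _ <-//] := BP i; apply: leq_trans kg (growth_mono (ltnW mi)).
  apply: (@leq_trans (\sum_(i < m.+1) m.+2 ^ n)).
    by apply: leq_sum => i _; apply: Fn; have [] := BP i.
  by rewrite sum_nat_const card_ord expnS leq_mul2r leqnSn orbT.
Qed.

End SlowSets.

Lemma cof_Fsigma_neq0 : [set X | exists I : set (set nat),
    [/\ ideal_on_omega I, tall I, Fsigma_family I, sigma_pseudobounded I &
        directed X /\ cofinal I X]] !=set0.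
Proof.
exists slow_ideal, slow_ideal; split.
- exact: slow_ideal_ideal.
- exact: slow_ideal_tall.
- apply: sigma_pseudobounded_Fsigma slow_ideal_sigma_pseudobounded.
  exact: slow_ideal_sub.
- exact: slow_ideal_sigma_pseudobounded.
have [[sub cup fin] _] := slow_ideal_ideal.
split; last by split=> // A IA; exists A.
split; first by exists set0; exact/fin.
by move=> A B IA IB; exists (A `|` B); split;
  [exact: cup|apply/subsetPset => x; left|apply/subsetPset => x; right].
Qed.

(** * Tall ideals and the P-ideal dichotomy *)

Lemma countable_layered {d} {T : porderType d} (D : set T) :
  directed D -> countable D -> layered D.
Proof.
move=> Ddir /countable_inj[r rinj]; exists r => n A AD _ rA.
apply: directed_finite_bounded => //; apply: card_le_finite (finite_II n.+1).
by apply: (card_le_inj (f := r)) => [x /rA|x y /AD Dx /AD Dy /rinj]; last exact.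
Qed.

(* Otherwise X would make I countably generated. *)
Lemma tall_not_layered (I X : set (set nat)) :
  ideal_on_omega I -> tall I -> cofinal I X -> ~ layered X.
Proof.
move=> [[Isub Icup Ifin] IT] It [XI Xcof] [r rP].
(* [U n] is covered by countably many members of [X] of rank at most [n], one for each of its
   points, and these have a common bound. *)
pose U n := \bigcup_(A in [set A | X A /\ r A <= n]) A.
have IU n : I (U n).
  have /choice[A AP] k : exists A, U n k -> [/\ X A, r A <= n & A k].
    have [[A [XA rA] Ak]|nU] := pselect (U n k); first by exists A.
    by exists set0.
  have [|||Z [XZ ZA]] := rP n (A @` U n).
  - by move=> _ [k /AP[] ? _ _ <-].
  - exact: countable_image.
  - by move=> _ [k /AP[] ? ? _ <-].
  apply: Isub (XI _ XZ) => k Uk; have [_ _ Ak] := AP _ Uk.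
  have /ZA : (A @` U n) (A k) by exists k.
  by rewrite subsetEset; apply.
have Umono m n : m <= n -> U m `<=` U n.
  by move=> mn k [A [XA rA] Ak]; exists A => //; split=> //; exact: leq_trans mn.
(* As [I] is proper, [U n] has infinite complement. A member of [X] of rank [r A] lies in [U (r A)],
   which contains no [x n] with [r A <= n]. *)
have /choice[x xP] n : exists k, ~ U n k /\ n <= k.
  suff /infinite_nat_unbounded/(_ n)[k Uk nk] : infinite_set (~` U n) by exists k.
  by move=> /Ifin IC; apply: IT; rewrite -(setUv (U n)); exact: Icup.
have [|B [Bx Binf IB]] := It (range x).
  apply: unbounded_nat_infinite => n.
  by exists (x n); [exists n|have [] := xP n].
have [A XA] := Xcof _ IB; rewrite subsetEset => BA; apply: Binf.
apply: sub_finite_set (finite_image x (finite_II (r A))) => k Bk.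
have [n _ xn] := Bx _ Bk; exists n => //=; rewrite ltnNge; apply/negP => /Umono UA.
by have [+ _] := xP n; apply; apply: UA; exists A => //; rewrite xn; exact: BA.
Qed.

Lemma cof_Fsigma_spec : exists I : set (set nat),
  [/\ ideal_on_omega I, tall I, Fsigma_family I, sigma_pseudobounded I &
      directed cof_Fsigma /\ cofinal I cof_Fsigma].
Proof. by have [] := least_cardP cof_Fsigma_neq0. Qed.

Lemma cof_Fsigma_uncountable : ~ countable cof_Fsigma.
Proof.
have [I [Iid It _ _ [cdir ccof]]] := cof_Fsigma_spec.
by move=> /(countable_layered cdir); exact: (tall_not_layered Iid It ccof).
Qed.

Lemma cof_Fsigma_le (I X : set (set nat)) : ideal_on_omega I -> tall I ->
  sigma_pseudobounded I -> directed X -> cofinal I X -> cof_Fsigma #<= X.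
Proof.
move=> Iid It Isp Xdir Xcof; have [_ cle] := least_cardP cof_Fsigma_neq0.
apply: cle; exists I; split=> //; apply: sigma_pseudobounded_Fsigma => //.
by have [[]] := Iid.
Qed.

Lemma frakb_spec : unbounded_family frakb /\
  forall F, unbounded_family F -> frakb #<= F.
Proof.
apply: least_cardP; exists setT => -[g /(_ g I)[n _ ng]].
by have := ng _ (leqnn n); rewrite /= ltnn.
Qed.

(** When the minimum is [cof_Fsigma], uncountability of [cof_Fsigma] replaces comparability: [frakb]
    of size at most [omega1] would be at most [cof_Fsigma]. *)
Lemma card_lt_min : card_lt [set: omega1] [set: card_min frakb cof_Fsigma] <->
  ~ (frakb #<= [set: omega1]) /\ ~ (cof_Fsigma #<= [set: omega1]).
Proof.
have ltE T (A : set T) : card_lt [set: omega1] [set: set_type A] <->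
    ~ (A #<= [set: omega1]).
  rewrite /card_lt (card_le_eqr (card_setT A)) (card_le_eql (card_setT A)).
  split=> [/andP[_ /negP]//|nA]; apply/andP; split; last exact/negP.
  exact/uncountable_ge_omega1/uncountable_of_not_le.
have cge := uncountable_ge_omega1 cof_Fsigma_uncountable.
rewrite /card_min; case: ifPn => [bc|/negP nbc]; rewrite ltE; split=> [nle|[]//].
  by split=> // cle; apply: nle; exact: card_le_trans cle.
by split=> // ble; apply: nbc; exact: card_le_trans cge.
Qed.

Section PIdealDichotomy.
Hypothesis pid : PID.
Hypothesis frakb_gt : ~ (frakb #<= [set: omega1]).

Lemma lt_star_bound (F : set (nat -> nat)) : F #<= [set: omega1] ->
  exists g, forall f, F f -> exists N, forall n, N <= n -> f n < g n.
Proof.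
move=> Fle; have [_ bF] := frakb_spec.
have [g gF] : exists g, forall f, F f -> lt_star f g.
  apply: contrapT => /bF bleF; apply: frakb_gt; exact: card_le_trans Fle.
by exists g => f /gF[N _ NP]; exists N => n /NP.
Qed.

(** [f B n] bounds the indices in [A n] of the points of [B]. If [g] eventually exceeds every [f B],
    the points of [A n] of index above [g n], over all [n], form a pseudo-union that meets [B]
    within finitely many of the [A n]. *)
Lemma orthogonal_P_ideal {X : Type} (F : set (set X)) : F #<= [set: omega1] ->
  P_ideal [set A | countable A /\ forall B, F B -> finite_set (A `&` B)].
Proof.
move=> Fle; split=> [|A []//|A /all_and2[cA Afin]].
  split=> [A B AB [cB Bfin]|A B [cA Afin] [cB Bfin]|A Afin].
  - split=> [|C /Bfin]; first exact: countable_sub cB.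
    by apply: sub_finite_set; exact: setSI.
  - split=> [|C FC]; first exact: countable_setU.
    by rewrite setIUl finite_setU; split; [exact: Afin|exact: Bfin].
  - split=> [|C _]; first exact: finite_set_countable.
    exact: finite_setIl.
have /choice[q qinj] n : exists f : X -> nat,
    forall x y, A n x -> A n y -> f x = f y -> x = y.
  exact/countable_inj.
have /choice[f fP] (B : set X) : exists f : nat -> nat, F B ->
    forall n x, A n x -> B x -> q n x <= f n.
  have [FB|nFB] := pselect (F B); last by exists id.
  suff /choice[f fP] n : exists k, forall x, A n x -> B x -> q n x <= k.
    by exists f.
  have [k kP] := finite_nat_bound (finite_image (q n) (Afin n B FB)).
  by exists k => x Ax Bx; apply: kP; exists x.
have [g gP] := lt_star_bound (card_le_trans (card_image_le f F) Fle).
exists (\bigcup_n (A n `&` [set x | g n < q n x])) => [|n].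
  split=> [|B FB].
    apply: bigcup_countable => // n _.
    by apply: countable_sub (cA n); exact: subIsetl.
  have [|N Ng] := gP (f B); first by exists B.
  apply: (@sub_finite_set _ _ (\bigcup_(n in `I_N) (A n `&` B))).
    move=> x [[n _ [Ax gx]] Bx]; exists n => //=.
    rewrite ltnNge; apply/negP => /Ng; rewrite ltnNge => /negP; apply.
    by apply: leq_trans (ltnW gx) _; exact: fP.
  by apply: bigcup_finite => // n _; exact: Afin.
apply: card_le_finite (finite_II (g n).+1).
apply: (card_le_inj (f := q n)) => [x [Ax nx]|x y [Ax _] [Ay _]]; last exact: qinj.
by rewrite /= ltnS leqNgt; apply/negP => gx; apply: nx; exists n.
Qed.

(** The dichotomy is applied on the subtype of [D]. An uncountable set with all countable subsets in
    the ideal yields the family [e]; an infinite countable subset of a piece [Y n] is outside the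
    ideal, so it meets some initial segment in an infinite, bounded set. *)
Lemma finite_subsets_or_sigma_pseudobounded {d} {T : porderType d} (D : set T) :
  directed D -> D #<= [set: omega1] ->
  tukey_le [set A : set omega1 | finite_set A] D \/ sigma_pseudobounded D.
Proof.
move=> Ddir Dle; pose below (x : D) := [set y : D | (val y <= val x)%O].
have Fle : range below #<= [set: omega1].
  by apply: card_le_trans (card_image_le _ _) _; rewrite (card_le_eql (card_setT D)).
have [[Y [nY YI]]|[Y YE YnI]] := pid (orthogonal_P_ideal Fle).
  left; have [e [einj eY]] := uncountable_omega1_inj nY.
  apply: (finite_subsets_tukey_le Ddir (e := val \o e)) => [a|x Dx].
    exact: set_valP.
  apply: contrapT => /infinite_countable_sub[K [Kx Kinf cK]].
  have [||_ fin] := YI (e @` K).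
  - by move=> _ [a _ <-].
  - exact: countable_image.
  have {}fin : finite_set (e @` K `&` below (SigSub (mem_set Dx))).
    by apply: fin; exists (SigSub (mem_set Dx)).
  apply: (@infinite_image _ _ e K) => [a b _ _ /einj//|//|].
  by apply: sub_finite_set fin => _ [a Ka <-]; split; [exists a|exact: Kx].
right; exists (fun n => val @` Y n) => [n|]; last first.
  apply/seteqP; split=> [x Dx|x [n _ [y _ <-]]]; last exact: set_valP.
  have : [set: D] (SigSub (mem_set Dx)) by [].
  by rewrite YE => -[n _ Yx]; exists n => //; exists (SigSub (mem_set Dx)).
split=> [_ [y _ <-]|A AY Ainf cA]; first exact: set_valP.
have AE : val @` (val @^-1` A : set D) = A.
  apply/seteqP; split=> [_ [y Ay <-]//|x Ax].
  by have [y _ yx] := AY _ Ax; exists y => //=; rewrite yx.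
have [x xinf] : exists x : D, infinite_set ((val @^-1` A) `&` below x).
  apply: contrapT => nx; apply: (YnI n (val @^-1` A)).
  - move=> y /AY[z Yz /val_inj zy]; by rewrite -zy.
  - apply: card_le_trans cA; apply: (card_le_inj (f := val)) => // y z _ _.
    exact: val_inj.
  - by move=> fin; apply: Ainf; rewrite -AE; exact: finite_image.
  split=> [|_ [x _ <-]].
    apply: card_le_trans cA; apply: (card_le_inj (f := val)) => // y z _ _.
    exact: val_inj.
  by apply: contrapT => xinf; apply: nx; exists x.
exists (val @` ((val @^-1` A) `&` below x)); split.
- by move=> _ [y [Ay _] <-].
- by apply: infinite_image => // y z _ _; exact: val_inj.
- by exists (val x); split=> [|_ [y [_ yx] <-]//]; exact: set_valP.
Qed.

End PIdealDichotomy.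

Section SigmaPseudoboundedLayered.
Context {d : Order.disp_t} {T : porderType d}.
Variable D : set T.
Hypotheses (Ddir : directed D) (Dle : D #<= [set: omega1]).
Hypothesis Dsp : sigma_pseudobounded D.
Hypothesis cof_gt : ~ (cof_Fsigma #<= [set: omega1]).

(* If a sequence u in X is unbounded, then the sets of indices k for which the
   u k have a common bound form an ideal that contradicts cof_gt. *)
Lemma pseudobounded_countable_bounded X A : pseudobounded D X ->
  A `<=` X -> countable A -> bounded_in D A.
Proof.
move=> Xpb AX cA; have AD : A `<=` D by move=> x /AX; have [XD _] := Xpb; exact: XD.
have [->|/set0P A0] := eqVneq A set0.
  by have [x Dx] := proj1 Ddir; exists x; split=> // y.
have [u [v [uA vP]]] := card_le_retract A0 cA.
apply: contrapT => nA; apply: cof_gt.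
pose below x := [set k | (u k <= x)%O].
have below_mono x y : (x <= y)%O -> below x `<=` below y.
  by move=> xy k /= kx; exact: le_trans xy.
pose J := [set S | exists2 x, D x & S `<=` below x].
have Dub x y : D x -> D y -> exists z, [/\ D z, (x <= z)%O & (y <= z)%O].
  exact: (proj2 Ddir).
(* The sets [below x] with [x] in [D] are directed and cofinal in [J], and there are at most
   [omega1] of them. *)
suff : cof_Fsigma #<= below @` D.
  by move=> /card_le_trans; apply; apply: card_le_trans Dle; exact: card_image_le.
apply: (@cof_Fsigma_le J).
- split.
    split=> [S S' SS' [x Dx S'x]|S S' [x Dx Sx] [y Dy S'y]|S Sfin].
    + by exists x => //; exact: subset_trans S'x.
    + have [z [Dz xz yz]] := Dub _ _ Dx Dy; exists z => // k [/Sx|/S'y].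
        exact: below_mono.
      exact: below_mono.
    + have [||x [Dx xS]] := @directed_finite_bounded _ _ _ (u @` S) Ddir.
      * by move=> _ [k _ <-]; exact/AD/uA.
      * exact: finite_image.
      by exists x => // k Sk; apply: xS; exists k.
  move=> [x Dx xT]; apply: nA; exists x; split=> // y /vP[_ <-].
  exact: xT.
- move=> S Sinf.
  have [|y Dy yinf] := pseudobounded_family (e := u) Xpb Sinf.
    by move=> k _; exact: AX.
  exists (S `&` below y); split=> //; exists y => //; exact: subIsetr.
- have [Y Ypb DE] := Dsp.
  exists (fun n => [set S | exists2 x, Y n x & S `<=` below x]) => [n|]; last first.
    apply/seteqP; split=> [S [x]|S [n _ [x Yx Sx]]].
      by rewrite DE => -[n _ Yx] Sx; exists n => //; exists x.
    by exists x => //; rewrite DE; exists n.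
  split=> [S [x Yx Sx]|F FY Finf _].
    by exists x => //; rewrite DE; exists n.
  have [x0 _] := A0.
  have /choice[e eP] S : exists x, F S -> Y n x /\ S `<=` below x.
    by have [/FY[x Yx Sx]|nF] := pselect (F S); [exists x|exists x0].
  have [|y Dy yinf] := pseudobounded_family (e := e) (Ypb n) Finf.
    by move=> S /eP[].
  exists (F `&` [set S | (e S <= y)%O]); split=> //.
  exists (below y); split; first by exists y.
  move=> S [/eP[_ Se] /= ey]; rewrite subsetEset.
  exact: subset_trans Se (below_mono _ _ ey).
- split; first by have [x Dx] := proj1 Ddir; exists (below x), x.
  move=> _ _ [x Dx <-] [y Dy <-]; have [z [Dz xz yz]] := Dub _ _ Dx Dy.
  exists (below z); rewrite !subsetEset.
  by split; [exists z|exact: below_mono|exact: below_mono].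
- split=> [_ [x Dx <-]|S [x Dx Sx]]; first by exists x.
  by exists (below x); [exists x|rewrite subsetEset].
Qed.

(** Ranked by the index of a piece containing each point, a countable set of bounded rank splits
    into finitely many bounded sets. *)
Lemma sigma_pseudobounded_layered : layered D.
Proof.
have [X Xpb DE] := Dsp.
have /choice[r rP] x : exists n, D x -> X n x.
  have [Dx|nDx] := pselect (D x); last by exists 0.
  by move: (Dx); rewrite {1}DE => -[n _ Xx]; exists n.
exists r => n A AD cA An.
have /choice[y yP] i : exists y, D y /\ forall x, A x -> r x = i -> (x <= y)%O.
  have [||y [Dy yA]] :=
      @pseudobounded_countable_bounded (X i) (A `&` r @^-1` [set i]) (Xpb i).
  - by move=> x [/AD/rP Xx /= <-].
  - by apply: countable_sub cA; exact: subIsetl.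
  by exists y; split=> // x Ax rx; apply: yA.
have [||z [Dz zy]] := @directed_finite_bounded _ _ _ (y @` `I_n.+1) Ddir.
- by move=> _ [i _ <-]; have [] := yP i.
- exact/finite_image/finite_II.
exists z; split=> // x Ax; have [_ /(_ _ Ax erefl) xy] := yP (r x).
apply: le_trans xy _; apply: zy; exists (r x) => //=.
by rewrite ltnS; exact: An.
Qed.

End SigmaPseudoboundedLayered.

(** * A directed set obtained from frakb *)

(** Eventual domination implies this, [N] absorbing the exceptions. The constant acts on values so
    as to match [lift_scale]. *)
Definition dominated (f g : nat -> nat) := exists N, forall i, f i <= maxn (g i) N.

Lemma dominated_trans g f h : dominated f g -> dominated g h -> dominated f h.
Proof.
move=> [M fg] [N gh]; exists (maxn M N) => i; have := fg i; have := gh i; lia.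
Qed.

Lemma dominated_le f g : (forall i, f i <= g i) -> dominated f g.
Proof. by exists 0 => i; rewrite maxn0. Qed.

Lemma countable_dominated (A : set (nat -> nat)) : countable A ->
  exists g, {homo g : m n / m <= n} /\ forall f, A f -> dominated f g.
Proof.
move=> cA; have [->|/set0P A0] := eqVneq A set0.
  by exists id; split=> // f [].
have [h [k [_ hP]]] := card_le_retract A0 cA.
exists (fun i => \max_(p < i.+1) \max_(j < i.+1) h p j); split=> [m n mn|f Af].
  apply/bigmax_leqP => p _; apply/bigmax_leqP => j _.
  have mn1 : m.+1 <= n.+1 by [].
  apply: leq_trans (leq_bigmax (widen_ord mn1 p)).
  exact: (leq_trans _ (leq_bigmax (widen_ord mn1 j))).
have [_ <-] := hP _ Af; exists (\max_(j < k f) h (k f) j) => i.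
have [ik|ki] := ltnP i (k f).
  apply: leq_trans (leq_maxr _ _).
  exact: (leq_bigmax_cond (Ordinal ik)).
apply: leq_trans (leq_maxl _ _).
have ki1 : k f < i.+1 by [].
apply: leq_trans (leq_bigmax (Ordinal ki1)).
exact: (leq_trans _ (leq_bigmax (@ord_max i))).
Qed.

Lemma exists_scale : frakb #<= [set: omega1] ->
  exists f : omega1 -> nat -> nat,
    [/\ forall a, {homo f a : m n / m <= n},
        forall a b, (a < b)%O -> dominated (f a) (f b) &
        forall g, exists a, ~ dominated (f a) g].
Proof.
move=> ble; have [bub _] := frakb_spec.
have b0 : frakb !=set0.
  by apply/set0P/eqP => b0; apply: bub; exists id => f; rewrite b0.
have [u [v [_ uP]]] := card_le_retract b0 ble.
have [||f fP] := @omega1_rec (nat -> nat) id (fun a h y =>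
    [/\ {homo y : m n / m <= n}, dominated (u a) y &
        forall b, (b < a)%O -> dominated (h b) y]).
- move=> a h.
  have cA : countable ([set u a] `|` h @` [set b | (b < a)%O]).
    apply: countable_setU; first exact: countable1.
    exact/countable_image/omega1_lt_countable.
  have [g [gmono gP]] := countable_dominated cA; exists g; split=> //.
    by apply: gP; left.
  by move=> b ba; apply: gP; right; exists b.
- by move=> a h h' y hh' [ymono uy hy]; split=> // b ba; rewrite -hh' //; exact: hy.
exists f; split=> [a|a b ab|g].
- by have [] := fP a.
- by have [_ _] := fP b; apply.
apply: contrapT => nfg; apply: bub.
(* The summand [i.+1] outgrows the constant of [dominated], which gives [lt_star]. *)
exists (fun i => g i + i.+1) => h /uP[_ <-].
have [N hN] : dominated (u (v h)) g.
  apply: (@dominated_trans (f (v h))); first by have [] := fP (v h).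
  by apply: contrapT => nh; apply: nfg; exists (v h).
exists N => // i /= Ni; have := hN i; lia.
Qed.

Section LiftedScale.
Variable f : omega1 -> nat -> nat.
Hypotheses (fmono : forall a, {homo f a : m n / m <= n})
  (fdom : forall a b, (a < b)%O -> dominated (f a) (f b))
  (funb : forall g, exists a, ~ dominated (f a) g).

(** Maxima with constants turn [dominated] into a pointwise inequality, which makes the range
    directed. *)
Definition lift_scale (p : omega1 * nat) (i : nat) : nat := maxn (f p.1 i) p.2.

Let D : set (nat -> nat) := range lift_scale.

Let dom_le a b : (a <= b)%O -> dominated (f a) (f b).
Proof. by rewrite le_eqVlt => /predU1P[->|/fdom//]; exact: dominated_le. Qed.

Lemma lift_scale_card : D #<= [set: omega1].
Proof. exact: card_le_trans (card_image_le _ _) card_omega1_nat. Qed.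

Lemma lift_scale_directed : directed D.
Proof.
split; first by have [a _] := funb id; exists (lift_scale (a, 0)), (a, 0).
move=> _ _ [[a m] _ <-] [[b n] _ <-].
wlog ab : a b m n / (a <= b)%O.
  move=> wl; have [|/ltW ba] := leP a b; first exact: wl.
  by have [z [Dz zb za]] := wl _ _ n m ba; exists z.
have [N fN] := dom_le ab.
exists (lift_scale (b, maxn N (maxn m n))); split; first by eexists.
  by apply/lefP => i; rewrite /lift_scale leEnat /=; have := fN i; lia.
by apply/lefP => i; rewrite /lift_scale leEnat /=; lia.
Qed.

Lemma lift_scale_not_layered : ~ layered D.
Proof.
move=> [r rP].
(* Some rank suffices to dominate the whole scale: otherwise each [n] has a counterexample [s n],
   and the lift of an [f b] beyond all of them contradicts its own rank. *)
have [n nP] : exists n, forall a, exists x, [/\ D x, r x <= n & dominated (f a) x].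
  apply: contrapT => nn.
  have /choice[s sP] n : exists a, forall x, D x -> r x <= n -> ~ dominated (f a) x.
    apply: contrapT => na; apply: nn; exists n => a; apply: contrapT => nx.
    apply: na; exists a => x Dx rx fx; apply: nx; by exists x.
  have [b bP] := omega1_countable_bound (@card_image_le _ _ s setT).
  have Dx : D (lift_scale (b, 0)) by exists (b, 0).
  apply: (sP _ _ Dx (leqnn _)).
  apply: (@dominated_trans (f b)); first by apply: fdom; apply: bP; eexists.
  by apply: dominated_le => i; rewrite /lift_scale leq_maxl.
(* Unboundedness at a coordinate would already show on countably many elements, which layering
   bounds. This [g] dominates every [f a]. *)
have /choice[g gP] i : exists k, forall x, D x -> r x <= n -> x i <= k.
  apply: contrapT => nk.
  have /choice[x xP] k : exists x, [/\ D x, r x <= n & k <= x i].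
    apply: contrapT => nx; apply: nk; exists k => x Dx rx.
    by rewrite leqNgt; apply/negP => /ltnW kx; apply: nx; exists x.
  have [|||y [_ yx]] := rP n (range x).
  - by move=> _ [k _ <-]; have [] := xP k.
  - exact: card_image_le.
  - by move=> _ [k _ <-]; have [] := xP k.
  have /lefP/(_ i) : (x (y i).+1 <= y)%O by apply: yx; eexists.
  by rewrite leEnat; have [_ _ ] := xP (y i).+1; lia.
have [a na] := funb g; apply: na; have [x [Dx rx fx]] := nP a.
by apply: dominated_trans fx _; apply: dominated_le => i; exact: gP.
Qed.

(* A greedy colouring by natural numbers exists, and some class is uncountable. *)
Lemma uncountable_independent (G : omega1 -> omega1 -> Prop) :
  (forall b, finite_set [set a | (a < b)%O /\ G a b]) ->
  exists2 E : set omega1, ~ countable E &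
    forall a b, E a -> E b -> (a < b)%O -> ~ G a b.
Proof.
move=> Gfin.
have [||c cP] := @omega1_rec nat 0
    (fun b h y => forall a, (a < b)%O -> G a b -> h a <> y).
- move=> b h; have /infinite_setD/(_ (finite_image h (Gfin b))) := infinite_nat.
  move=> /infinite_setN0[y [_ ny]]; exists y => a ab Gab hy.
  by apply: ny; exists a.
- by move=> b h h' y hh' hy a ab; rewrite -hh' //; exact: hy.
have [|n nc] := @uncountable_bigcup _ _ (fun n => c @^-1` [set n]) (@omega1_uncountable).
  by move=> a _; exists (c a).
exists ([set: omega1] `&` c @^-1` [set n]) => // a b [_ /= ca] [_ /= cb] ab Gab.
by apply: (cP b a ab Gab); rewrite ca.
Qed.

(* The functions e a, for a in E, are unbounded on uncountable subsets. So beyond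
   a bound c of the indices of a countable dense set there is a first coordinate
   m at which their values are unbounded; any dense point b with the right values
   below m is dominated by f c from some level on, hence lies below every e a with
   the same values below m whose monotone tail starts above that level. *)
Lemma lift_scale_comparable (p : omega1 -> omega1 * nat) (E : set omega1) :
  ~ countable E -> exists a b, [/\ E a, E b, (a < b)%O &
    forall i, lift_scale (p a) i <= lift_scale (p b) i].
Proof.
move=> nE; apply: contrapT => indep.
pose e a := lift_scale (p a).
have e_mono a i j : i <= j -> e a i <= e a j.
  by move=> ij; have := fmono (p a).1 ij; rewrite /e /lift_scale; lia.
have e_inj a b : E a -> E b -> e a = e b -> a = b.
  move=> Ea Eb eab; case: (ltgtP a b) => // ab; case: indep.
    by exists a, b; split=> // i; rewrite -/(e a) eab.
  by exists b, a; split=> // i; rewrite -/(e b) -eab.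
(* [e] is injective on [E], and only countably many lifts have a scale index at most [c]. *)
have small c : countable (E `&` [set a | ((p a).1 <= c)%O]).
  have cS : countable (lift_scale @` ([set a | (a <= c)%O] `*` [set: nat])).
    by apply/countable_image/countableX => //; exact: omega1_initial_countable.
  apply: card_le_trans cS; apply: (card_le_inj (f := e)) => [a [Ea ac]|].
    by exists (p a).
  by move=> a b [Ea _] [Eb _]; exact: e_inj.
have unb (F : set omega1) : F `<=` E -> ~ countable F ->
    exists m, forall k, exists2 a, F a & k <= e a m.
  move=> FE nF; apply: contrapT => bF.
  have /choice[g gP] m : exists k, forall a, F a -> e a m <= k.
    apply: contrapT => nk; apply: bF; exists m => k.
    apply: contrapT => nka; apply: nk; exists k => a Fa.
    by rewrite leqNgt; apply/negP => /ltnW ka; apply: nka; exists a.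
  have [c nc] := funb g; apply: nc.
  have [a [Fa ac]] := uncountable_neq0 (uncountableD nF (small c)).
  have {}ac : (c < (p a).1)%O.
    by rewrite ltNge; apply/negP => ac'; apply: ac; split=> //; exact: FE.
  apply: dominated_trans (fdom ac) _; apply: dominated_le => i.
  by apply: leq_trans (gP i a Fa); rewrite /e /lift_scale leq_maxl.
(* A countable subset of E dense for the topology of pointwise convergence. *)
have [C [CE cC Cdense]] : exists C, [/\ C `<=` E, countable C &
    forall a m, E a -> exists2 b, C b & forall i, i < m -> e b i = e a i].
  have [a0 Ea0] := uncountable_neq0 nE.
  have /choice[s sP] (t : seq nat) : exists a, E a /\
      forall b, E b -> mkseq (e b) (size t) = t -> mkseq (e a) (size t) = t.
    have [[a [Ea at_]]|na] := pselect (exists a, E a /\ mkseq (e a) (size t) = t).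
      by exists a.
    by exists a0; split=> // b Eb bt; case: na; exists b.
  exists (range s); split=> [_ [t _ <-]||a m Ea]; first by have [] := sP t.
    exact/countable_image.
  exists (s (mkseq (e a) m)); first by eexists.
  move=> i im; have [_ /(_ a Ea)] := sP (mkseq (e a) m).
  rewrite size_mkseq => /(_ erefl)/(congr1 (fun t => nth 0 t i)).
  by rewrite !nth_mkseq.
have [c cP] := omega1_countable_bound (countable_image (fun a => (p a).1) cC).
have [z zP] := omega1_countable_bound cC.
pose E0 := E `\` ((E `&` [set a | ((p a).1 <= c)%O]) `|` [set a | (a <= z)%O]).
have nE0 : ~ countable E0.
  apply: uncountableD nE _.
  exact: countable_setU (small c) (@omega1_initial_countable z).
have E0P a : E0 a -> [/\ E a, (c < (p a).1)%O & (z < a)%O].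
  move=> [Ea na]; split=> //; rewrite ltNge; apply/negP => h; apply: na.
    by left.
  by right.
have [|N nE1] := @uncountable_bigcup _ E0
    (fun N => [set a | forall i, f c i <= maxn (f (p a).1 i) N]) nE0.
  by move=> a /E0P[_ /fdom[N fN] _]; exists N.
set E1 := E0 `&` _ in nE1.
have E1E : E1 `<=` E by move=> a [/E0P[]].
have [m munb mmin] : exists2 m, (forall k, exists2 a, E1 a & k <= e a m) &
    forall i, i < m -> exists k, forall a, E1 a -> e a i <= k.
  have ex : exists m, `[< forall k, exists2 a, E1 a & k <= e a m >].
    by have [m mP] := unb _ E1E nE1; exists m; exact/asboolP.
  case: (ex_minnP ex) => m /asboolP mP mmin; exists m => // i im.
  apply: contrapT => nk; have : m <= i; last by rewrite leqNgt im.
  apply/mmin/asboolP => k; apply: contrapT => nka; apply: nk; exists k => a E1a.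
  by rewrite leqNgt; apply/negP => /ltnW ka; apply: nka; exists a.
have [B BP] : exists B, forall i a, i < m -> E1 a -> e a i <= B.
  have /choice[g gP] i : exists k, i < m -> forall a, E1 a -> e a i <= k.
    have [im|mi] := ltnP i m; last by exists 0.
    by have [k kP] := mmin _ im; exists k.
  exists (\max_(i < m) g i) => i a im E1a; apply: leq_trans (gP _ im _ E1a) _.
  exact: (leq_bigmax (Ordinal im)).
have /choice[x xP] k : exists a, E1 a /\ k <= e a m.
  by have [a E1a ka] := munb k; exists a.
(* Values below [m] are at most [B], so one of finitely many patterns is shared by infinitely many
   [x k]. *)
pose code k : {ffun 'I_m -> 'I_B.+1} := [ffun i : 'I_m => inord (e (x k) i)].
have [t] := infinite_fiber infinite_nat (finite_finset (X := range code)).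
rewrite setTI => tinf.
have codeE k i : (code @^-1` [set t]) k -> i < m ->
    e (x k) i = (if insub i is Some j then t j else ord0 : 'I_B.+1).
  move=> /= kt im; rewrite insubT -kt ffunE inordK //= ltnS.
  by apply: BP => //; have [] := xP k.
have [k0 k0t] := infinite_setN0 tinf.
have [b Cb bP] := Cdense (x k0) m (E1E _ (proj1 (xP k0))).
have [|M bM] := fdom (a := (p b).1) (b := c).
  by apply: cP; exists b.
(* From [m] on, [e (x k)] is at least [k], hence at least all three constants that separate [e b]
   from [f c] and [f c] from the scale function of [x k]. *)
have [k kt kN] := infinite_nat_unbounded tinf (maxn N (maxn M (p b).2)).
have [E1k ek] := xP k; have [E0k Nk] := E1k; have [Ek _ zk] := E0P _ E0k.
apply: indep; exists b, (x k); split=> //; first exact: CE.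
  by apply: lt_trans zk; exact: zP.
move=> i; rewrite -/(e b) -/(e (x k)).
have [im|mi] := ltnP i m; first by rewrite bP // !codeE.
have := e_mono (x k) _ _ mi; have := bM i; have := Nk i.
rewrite /e /lift_scale in ek *; lia.
Qed.

(** Each [e b] is above only finitely many [e a], so some uncountable set of indices has no [a < b]
    with [e a <= e b], against [lift_scale_comparable]. *)
Lemma lift_scale_not_tukey_ge :
  ~ tukey_le [set A : set omega1 | finite_set A] D.
Proof.
move=> /finite_subsets_tukey_leE[e [eD efin]].
have /choice[p pE] a : exists q, lift_scale q = e a by have [q _ <-] := eD a; exists q.
have [|E nE Eindep] := @uncountable_independent (fun a b => (e a <= e b)%O).
  by move=> b; apply: sub_finite_set (efin _ (eD b)) => a [].
have [a [b [Ea Eb ab pab]]] := lift_scale_comparable p nE.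
apply: (Eindep a b Ea Eb ab); apply/lefP => i.
by rewrite -!pE; exact: pab.
Qed.

End LiftedScale.

(** * Cardinal inequality and the five cofinal types *)

Theorem theorem36 : PID ->
  (card_lt [set: omega1] [set: card_min frakb cof_Fsigma] <->
   forall (d : Order.disp_t) (T : porderType d) (D : set T),
     directed D -> D #<= [set: omega1] ->
     tukey_equiv D [set: 'I_1] \/
     tukey_equiv D [set: nat] \/
     tukey_equiv D [set: omega1] \/
     tukey_equiv D [set: nat *p omega1] \/
     tukey_equiv D [set A : set omega1 | finite_set A]).
Proof.
move=> pid; rewrite card_lt_min; split=> [[bgt cgt] d T D Ddir Dle|five].
  have [geD|spD] := finite_subsets_or_sigma_pseudobounded pid bgt Ddir Dle.
    by do 4 right; split=> //; exact: tukey_le_finite_subsets.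
  have := layered_tukey_equiv Ddir Dle (sigma_pseudobounded_layered Ddir Dle spD cgt).
  by case=> ?; [left|right; left|do 2 right; left|do 3 right; left].
(* Sets Tukey below any of the first four types are layered, so such a [D] would have a sixth
   type. *)
have absurd d (T : porderType d) (D : set T) : directed D -> D #<= [set: omega1] ->
    ~ layered D -> ~ tukey_le [set A : set omega1 | finite_set A] D -> False.
  move=> Ddir Dle nlay nge.
  have [[le1 _]|[[le1 _]|[[le1 _]|[[le1 _]|[_ //]]]]] := five _ _ _ Ddir Dle.
  - apply/nlay/(tukey_le_layered le1)/(@layered_max _ _ _ ord0) => // i _.
    by rewrite ord1.
  - exact/nlay/(tukey_le_layered le1)/layered_nat.
  - exact/nlay/(tukey_le_layered le1)/layered_omega1.
  - exact/nlay/(tukey_le_layered le1)/layered_nat_omega1.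
split=> [/exists_scale[f [fmono fdom funb]]|cle].
  apply: (absurd _ _ (range (lift_scale f))).
  - exact: lift_scale_directed.
  - exact: lift_scale_card.
  - exact: lift_scale_not_layered.
  - exact: lift_scale_not_tukey_ge.
have [I [Iid It _ Isp [cdir ccof]]] := cof_Fsigma_spec.
apply: (absurd _ _ cof_Fsigma cdir cle).
- exact: tall_not_layered Iid It ccof.
- exact: sigma_pseudobounded_not_tukey_ge Isp ccof.
Qed.
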